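(* Let $d \ge 2$ be an even integer and $N\ge 1$. Let $q_n, k_m \in \mathbb{R}^{1\times d}$, for $n,m\in\{0,\dots,N-1\}$, be random query and key row vectors with square-integrable entries, such that the means $E[q_n^{(i)}]$ and $E[k_m^{(j)}]$ and the covariances $E\big[(q_n^{(i)}-E[q_n^{(i)}])(k_m^{(j)}-E[k_m^{(j)}])\big]=\sigma_{i,j}$ do not depend on the positions $n,m$, for all $i,j\in\{0,\dots,d-1\}$. Let $$z_{n,m} = \mathrm{RoPE}(q_n,n)\,\mathrm{RoPE}(k_m,m)^{T}$$ be the dot product of the RoPE-transformed query and key vectors. Then the expectation of $z_{n,m}$ depends on $(n,m)$ only through the relative position $n-m$. More precisely, there exist real constants $A_0,\dots,A_{d-1}$ and $B_0,\dots,B_{d-1}$, depending only on the means $E[q_n^{(i)}]$, $E[k_m^{(j)}]$ and the covariances $\sigma_{i,j}$ ($i,j\in\{0,\dots,d-1\}$) of the query and key distributions (and not on $n$ or $m$), such that for all $n,m\in\{0,\dots,N-1\}$, $$E[z_{n,m}] = \sum_{i=0}^{d-1} \phi_{n-m}^{(i)}\, A_i + \sum_{i=0}^{d-1} \psi_{n-m}^{(i)}\, B_i .$$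
   Context: Vector coordinates are indexed by $0,\dots,d-1$, and $x^{(i)}$ denotes the $i$-th coordinate of $x\in\mathbb{R}^{1\times d}$. The notation $i\%\frac d2$ means the remainder of $i$ modulo $d/2$. RoPE frequencies: $\theta_i = 10000^{-2i/d}$ for $i\in\{0,\dots,\frac d2-1\}$. Rotary position embedding (RoPE): for a row vector $x\in\mathbb{R}^{1\times d}$ and an integer position $n$, $\mathrm{RoPE}(x,n) = x W_n$, where $W_n\in\mathbb{R}^{d\times d}$ is the block rotation matrix $$W_n = \begin{pmatrix} C_n & S_n\\ -S_n & C_n\end{pmatrix},\qquad C_n=\mathrm{diag}\big(\cos(n\theta_0),\dots,\cos(n\theta_{d/2-1})\big),\quad S_n=\mathrm{diag}\big(\sin(n\theta_0),\dots,\sin(n\theta_{d/2-1})\big),$$ that is, coordinate $i$ is paired with coordinate $i+\frac d2$ for $0\le i<\frac d2$. Trigonometric basis functions: for an integer $r$ and $i\in\{0,\dots,d-1\}$, $$\phi_r^{(i)} = \cos\big(r\,\theta_{i\%\frac d2}\big),\qquad \psi_r^{(i)} = (-1)^{\mathbf 1[i\ge d/2]}\,\sin\big(r\,\theta_{i\%\frac d2}\big).$$ *)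

(* Defs.v *)
From HB Require Import structures.
From mathcomp Require Import all_boot all_order all_algebra.
From mathcomp Require Import all_classical all_reals all_analysis.

Set Implicit Arguments.
Unset Strict Implicit.
Unset Printing Implicit Defensive.

Import Order.TTheory GRing.Theory Num.Theory.

Local Open Scope ring_scope.

Lemma half_add_half (d : nat) (d_even : ~~ odd d) : (d./2 + d./2)%N = d.
Proof. by rewrite addnn even_halfK. Qed.

Definition rope_freq (R : realType) (d i : nat) : R :=
  10000 `^ (- (2 * i%:R / d%:R)).

Definition rope_cos (R : realType) (d : nat) (n : int) : 'M[R]_(d./2) :=
  diag_mx (\row_(i < d./2) cos (n%:~R * rope_freq R d i)).

Definition rope_sin (R : realType) (d : nat) (n : int) : 'M[R]_(d./2) :=
  diag_mx (\row_(i < d./2) sin (n%:~R * rope_freq R d i)).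

(* The block matrix has size d./2 + d./2, which equals d only propositionally,
   hence the cast. *)
Definition rope_mx (R : realType) (d : nat) (d_even : ~~ odd d) (n : int) :
    'M[R]_d :=
  castmx (half_add_half d_even, half_add_half d_even)
    (block_mx (rope_cos R d n) (rope_sin R d n)
              (- rope_sin R d n) (rope_cos R d n)).

Definition RoPE (R : realType) (d : nat) (d_even : ~~ odd d)
    (x : 'rV[R]_d) (n : int) : 'rV[R]_d :=
  x *m rope_mx R d_even n.

Definition rope_score (R : realType) (d : nat) (d_even : ~~ odd d)
    (x y : 'rV[R]_d) (n m : int) : R :=
  (RoPE d_even x n *m (RoPE d_even y m)^T) 0 0.

Definition rope_phi (R : realType) (d : nat) (r : int) (i : nat) : R :=
  cos (r%:~R * rope_freq R d (i %% d./2)).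

Definition rope_psi (R : realType) (d : nat) (r : int) (i : nat) : R :=
  (-1) ^+ (d./2 <= i)%N * sin (r%:~R * rope_freq R d (i %% d./2)).

(* Main.v *)
(* The rotations satisfy W_n W_m^T = W_(n-m), so the score of x at n and y at m
   is x W_(n-m) y^T.  Row i of W_r has only two nonzero entries: phi_r(i) on the
   diagonal and psi_r(i) in the column i' of the coordinate paired with i.
   Hence A_i = E[q_i k_i] and B_i = E[q_i k_i'], which the means and the
   covariances determine. *)

Require Import Defs.
From HB Require Import structures.
From mathcomp Require Import all_boot all_order all_algebra.
From mathcomp Require Import all_classical all_reals all_analysis.
From mathcomp Require Import ring.

Set Implicit Arguments.
Unset Strict Implicit.
Unset Printing Implicit Defensive.

Import Order.TTheory GRing.Theory Num.Theory.

Local Open Scope ring_scope.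

Lemma castmx_mul_tr (S : pzSemiRingType) (m n : nat) (e : m = n)
    (A B : 'M[S]_m) :
  castmx (e, e) A *m (castmx (e, e) B)^T = castmx (e, e) (A *m B^T).
Proof. by case: n / e; rewrite !castmx_id. Qed.

(** All blocks are diagonal, so the block product is computed entrywise, where it reduces to the
    subtraction formulas for [cos] and [sin]. *)
Lemma rope_mx_mul_tr (R : realType) (d : nat) (d_even : ~~ odd d) (n m : int) :
  rope_mx R d_even n *m (rope_mx R d_even m)^T = rope_mx R d_even (n - m).
Proof.
rewrite /rope_mx castmx_mul_tr tr_block_mx mulmx_block linearN /= !tr_diag_mx.
rewrite !(mulmxN, mulNmx) opprK !mulmx_diag.
congr (castmx _ (block_mx _ _ _ _)); apply/matrixP => i j;
  rewrite !mxE -?mulNrn -mulrnDl rmorphB mulrBl ?(cosB, sinB);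
  congr (_ *+ _); ring.
Qed.

(** The swap of i and i + d/2, expressed by [split] and shifts so that it reduces along the halves
    of [block_mx]. *)
Definition rope_partner (d : nat) (d_even : ~~ odd d) (i : 'I_d) : 'I_d :=
  cast_ord (half_add_half d_even)
    match fintype.split (cast_ord (esym (half_add_half d_even)) i) with
    | inl j => rshift d./2 j
    | inr j => lshift d./2 j
    end.

Lemma rope_mxE (R : realType) (d : nat) (d_even : ~~ odd d) (r : int)
    (i j : 'I_d) :
  rope_mx R d_even r i j =
    rope_phi R d r i * (j == i)%:R
    + rope_psi R d r i * (j == rope_partner d_even i)%:R.
Proof.
set e := half_add_half d_even.
(* Indices are pulled back to ['I_(d./2 + d./2)], where the casts cancel and the block structure is
   visible. *)
rewrite -(cast_ordKV e i) -(cast_ordKV e j).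
move: (cast_ord _ i) (cast_ord _ j) => {}i {}j.
rewrite /rope_mx castmxE !cast_ordK /rope_partner cast_ordK.
rewrite !(inj_eq (@cast_ord_inj _ _ e)).
rewrite /rope_phi /rope_psi /=.
(* One case per block. Reduction modulo d/2 gives the index within the half, and the sign of
   [rope_psi] is that of the off-diagonal block: plus in the upper rows, minus in the lower. *)
case: (split_ordP i) => {}i -> /=; case: (split_ordP j) => {}j -> /=;
  rewrite ?(block_mxEul, block_mxEur, block_mxEdl, block_mxEdr);
  rewrite ?(eq_lshift, eq_rshift, eq_lrshift, eq_rlshift) !mxE;
  rewrite ?modnDl ?leq_addr ?(modn_small (ltn_ord i)) 1?leqNgt ?ltn_ord /=;
  rewrite eq_sym; case: eqP => // _;
  by rewrite ?mulr1n ?mulr0n ?mulr1 ?mulr0 ?expr0 ?expr1 ?mul1r ?mulN1r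
             ?addr0 ?add0r ?oppr0.
Qed.

Lemma rope_scoreE (R : realType) (d : nat) (d_even : ~~ odd d)
    (x y : 'rV[R]_d) (n m : int) :
  rope_score d_even x y n m =
    \sum_(i < d) (rope_phi R d (n - m) i * (x 0 i * y 0 i)
            + rope_psi R d (n - m) i * (x 0 i * y 0 (rope_partner d_even i))).
Proof.
rewrite /rope_score /RoPE trmx_mul mulmxA -(mulmxA x) rope_mx_mul_tr -mulmxA.
rewrite mxE; apply: eq_bigr => i _; rewrite mxE.
under eq_bigr do rewrite rope_mxE mxE mulrDl.
(* Each Kronecker delta leaves a single term: column i, then its partner. *)
rewrite big_split /= (bigD1 i) //= eqxx big1 ?addr0; last first.
  by move=> j /negbTE ->; rewrite mulr0 mul0r.
rewrite (bigD1 (rope_partner d_even i)) //= eqxx [X in _ + (_ + X)]big1.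
  by rewrite addr0 !mulr1 mulrDr mulrCA (mulrCA (x 0 i)).
by move=> j /negbTE ->; rewrite mulr0 mul0r.
Qed.

Lemma expectation_sum_ord (dsp : measure_display) (T : measurableType dsp)
    (R : realType) (P : probability T R) (n : nat) (X : 'I_n -> T -> R) :
  (forall i, X i \in Lfun P 1) ->
  'E_P[(fun w => \sum_i X i w)%R]%E = (\sum_i 'E_P[X i])%E.
Proof.
move=> LX; have := @expectation_sum _ _ _ P [seq X i | i <- index_enum 'I_n].
rewrite !big_map => <-; last by move=> _ /mapP[i _ ->].
by congr ('E_P[_]%E); apply/funext => w; rewrite fct_sumE.
Qed.

Lemma expectation_mul (dsp : measure_display) (T : measurableType dsp)
    (R : realType) (P : probability T R) (X Y : T -> R) :
  X \in Lfun P 2%:E -> Y \in Lfun P 2%:E ->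
  'E_P[(X \* Y)%R]%E = (covariance P X Y + 'E_P[X] * 'E_P[Y])%E.
Proof.
move=> X2 Y2; have XY1 := Lfun2_mul_Lfun1 X2 Y2.
have L21 := Lfun_subset12 (fin_num_measure P _ measurableT).
rewrite (covarianceE (L21 _ X2) (L21 _ Y2) XY1).
(* Cancelling in the extended reals requires a finite product of means; L2 lies in L1 for a
   probability measure, so both means are finite. *)
by rewrite subeK // fin_numM // expectation_fin_num // L21.
Qed.

Theorem theorem3p1 (R : realType) (d : nat) (d_ge2 : (2 <= d)%N)
    (d_even : ~~ odd d) :
  exists A B : 'rV[R]_d -> 'rV[R]_d -> 'M[R]_d -> 'I_d -> R,
  forall (dsp : measure_display) (T : measurableType dsp)
    (P : probability T R) (N : nat) (q k : 'I_N -> T -> 'rV[R]_d)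
    (mu_q mu_k : 'rV[R]_d) (sigma : 'M[R]_d),
  (1 <= N)%N ->
  (forall (n : 'I_N) (i : 'I_d), (fun w => q n w 0 i) \in Lfun P 2%:E) ->
  (forall (m : 'I_N) (j : 'I_d), (fun w => k m w 0 j) \in Lfun P 2%:E) ->
  (forall (n : 'I_N) (i : 'I_d),
     'E_P[(fun w => q n w 0 i)%R]%E = (mu_q 0 i)%:E) ->
  (forall (m : 'I_N) (j : 'I_d),
     'E_P[(fun w => k m w 0 j)%R]%E = (mu_k 0 j)%:E) ->
  (forall (n m : 'I_N) (i j : 'I_d),
     covariance P (fun w => q n w 0 i) (fun w => k m w 0 j)
     = (sigma i j)%:E) ->
  let z (n m : 'I_N) (w : T) : R :=
    rope_score d_even (q n w) (k m w) (n : nat)%:Z (m : nat)%:Z in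
  (forall n m n' m' : 'I_N,
     (n : nat)%:Z - (m : nat)%:Z = (n' : nat)%:Z - (m' : nat)%:Z ->
     'E_P[z n m]%E = 'E_P[z n' m']%E) /\
  (forall n m : 'I_N,
     'E_P[z n m]%E =
      (\sum_(i < d) rope_phi R d ((n : nat)%:Z - (m : nat)%:Z) i
                    * A mu_q mu_k sigma i
       + \sum_(i < d) rope_psi R d ((n : nat)%:Z - (m : nat)%:Z) i
                      * B mu_q mu_k sigma i)%:E).
Proof.
(* The mixed moment of q_i and k_j, written through the means and covariances alone so that it can
   be chosen before the probability space. *)
pose E (mu_q mu_k : 'rV[R]_d) (sigma : 'M[R]_d) i j :=
  sigma i j + mu_q 0 i * mu_k 0 j.
exists (fun mu_q mu_k sigma i => E mu_q mu_k sigma i i).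
exists (fun mu_q mu_k sigma i => E mu_q mu_k sigma i (rope_partner d_even i)).
move=> dsp T P N q k mu_q mu_k sigma _ q2 k2 Eq Ek cov z.
have L1 n m i j : (fun w => q n w 0 i) \* (fun w => k m w 0 j) \in Lfun P 1.
  exact: Lfun2_mul_Lfun1.
have Eqk n m i j : 'E_P[((fun w => q n w 0 i) \* (fun w => k m w 0 j))%R]%E
    = (E mu_q mu_k sigma i j)%:E.
  by rewrite expectation_mul // cov Eq Ek.
(* The formula contains n and m only through their difference, so it also yields the first claim. *)
suff Ez n m : 'E_P[z n m]%E =
    (\sum_(i < d) rope_phi R d ((n : nat)%:Z - (m : nat)%:Z) i
                  * E mu_q mu_k sigma i i
     + \sum_(i < d) rope_psi R d ((n : nat)%:Z - (m : nat)%:Z) i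
                  * E mu_q mu_k sigma i (rope_partner d_even i))%:E.
  by split=> // n m n' m' nm; rewrite !Ez nm.
set r := _ - _.
(* Stating the summands with pointwise operations on random variables lets linearity of expectation
   apply; [\o*] puts the scalar on the right. *)
pose X (i : 'I_d) := (rope_phi R d r i \o* ((fun w => q n w 0 i) \* (fun w => k m w 0 i)))
  \+ (rope_psi R d r i \o*
      ((fun w => q n w 0 i) \* (fun w => k m w 0 (rope_partner d_even i)))).
have -> : z n m = (fun w => \sum_i X i w).
  apply/funext => w; rewrite /z rope_scoreE; apply: eq_bigr => i _.
  by rewrite /X /= ![_ * rope_phi _ _ _ _]mulrC ![_ * rope_psi _ _ _ _]mulrC.
rewrite expectation_sum_ord => [|i]; last by rewrite rpredD ?Lfun_scale.
rewrite -big_split /= -sumEFin; apply: eq_bigr => i _.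
by rewrite expectationD ?Lfun_scale // !expectationZl // !Eqk.
Qed.
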